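(* Let $(p,q,r)\in P\cup P_1\cup P_2$ and $\nu+d(1/r-1/p)\ne0$. Assume that for $(p,q,r)\in P\cup P_1$ $$I_1=\int_T|\psi(t)|^{\frac{qp}{p-q}}k^{\frac p{p-q}}(t)\,d\mu(t)<\infty,\qquad I_{j+1}=\int_T|\psi(t)|^{\frac{qr}{p-q}}|\varphi_j(t)|^rk^{\frac r{p-q}}(t)\,d\mu(t)<\infty,\quad j=1,\ldots,n,$$ and for $(p,q,r)\in P_2$ $$I_1=\int_T\left(s_r^{-1}(t)(|\psi(t)|^p-1)_+\right)^{\frac p{r-p}}d\mu(t)<\infty,\qquad I_{j+1}=\int_T|\varphi_j(t)|^r\left(s_r^{-1}(t)(|\psi(t)|^p-1)_+\right)^{\frac r{r-p}}d\mu(t)<\infty,\quad j=1,\ldots,n.$$ Moreover, assume that $I_2=\ldots=I_{n+1}$. Then $$E(p,q,r)=\delta^\gamma I_1^{-\gamma/p}I_2^{-(1-\gamma)/r}(I_1+nI_2)^{1/q},\qquad \gamma=\frac{\nu-\eta-d(1/q-1/r)}{\nu+d(1/r-1/p)}.$$ The method $$\widehat m(y)(t)=k(\xi t)\psi(t)y(t),\qquad \xi=\left(\delta I_1^{-1/p}I_2^{1/r}\right)^{\frac1{\nu+d(1/r-1/p)}},$$ is optimal.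
   Context: $a_+=\max\{a,0\}$. Parameter sets (all exponents finite): $P=\{(p,q,r):1\le q<p,r<\infty\}$, $P_1=\{(p,q,r):1\le q=r<p<\infty\}$, $P_2=\{(p,q,r):1\le q=p<r<\infty\}$. $T$ is a cone in a linear space, with measure $\mu$ homogeneous of degree $d$ ($\mu(cA)=c^d\mu(A)$, $c>0$). The measurable functions $\psi,\varphi_1,\ldots,\varphi_n$ on $T$ are such that $|\psi|$ is homogeneous of degree $\eta$ ($|\psi(ct)|=c^\eta|\psi(t)|$, $c>0$), all $|\varphi_j|$ are homogeneous of degree $\nu$, and $\psi(t)\ne0$, $\sum_{j=1}^n|\varphi_j(t)|\ne0$ for almost all $t\in T$. Put $s_r(t)=\sum_{j=1}^n|\varphi_j(t)|^r$. The function $k$: for $(p,q,r)\in P$, $k(t)\in[0,1)$ is determined for almost all $t\in T$ by $$\frac{k^{\frac1{p-q}}(t)}{(1-k(t))^{\frac1{r-q}}}=s_r^{-\frac1{r-q}}(t)|\psi(t)|^{\frac{q(p-r)}{(p-q)(r-q)}};$$ for $(p,q,r)\in P_1$, $k(t)=(1-|\psi(t)|^{-q}s_q(t))_+$; for $(p,q,r)\in P_2$, $k(t)=\min\{1,|\psi(t)|^{-p}\}$. Recovery problem: let $\delta>0$, $\mathcal W=\{x\in L_p(T,\mu):\ \|\varphi_jx\|_{L_r(T,\mu)}<\infty,\ j=1,\ldots,n\}$, $W=\{x\in\mathcal W:\ \|\varphi_jx\|_{L_r(T,\mu)}\le1,\ j=1,\ldots,n\}$ (functions real- or complex-valued). It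 is assumed that $\Lambda x:=\psi x\in L_q(T,\mu)$ for all $x\in\mathcal W$. A recovery method is an arbitrary map $m\colon L_p(T,\mu)\to L_q(T,\mu)$, with error $$e(p,q,r,m)=\sup\{\|\Lambda x-m(y)\|_{L_q(T,\mu)}:\ x\in W,\ y\in L_p(T,\mu),\ \|x-y\|_{L_p(T,\mu)}\le\delta\}.$$ $E(p,q,r)=\inf_me(p,q,r,m)$ over all methods, and a method attaining the infimum is called optimal. *)

(* Defs.v *)
From HB Require Import structures.
From mathcomp Require Import all_boot all_order all_algebra.
From mathcomp Require Import all_classical all_reals all_analysis.
From mathcomp Require Import complex.

Set Implicit Arguments.
Unset Strict Implicit.
Unset Printing Implicit Defensive.
Import Order.TTheory GRing.Theory Num.Theory.
Local Open Scope classical_set_scope.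
Local Open Scope ring_scope.

(* A cone of the linear space L, given by its type T of points and its inclusion
   into L: the image of the inclusion is stable under multiplication by c > 0,
   and [dil c t] is the point c t of the cone.  Nothing is assumed about
   [dil c] for c <= 0. *)
Record cone_in (R : realType) (L : lmodType R) (T : Type) := ConeIn {
  incl : T -> L ;
  incl_inj : injective incl ;
  dil : R -> T -> T ;
  dilE : forall c t, 0 < c -> incl (dil c t) = c *: incl t
}.

(* The functions of the recovery problem are either all real-valued or all
   complex-valued. *)
Inductive scalar_kind := RealScalars | ComplexScalars.

Definition scalars (R : realType) (F : scalar_kind) : numFieldType :=
  match F with RealScalars => R | ComplexScalars => R[i] end.

Definition modulus (R : realType) (F : scalar_kind) : scalars R F -> R :=
  match F with
  | RealScalars => fun z : R => `|z|
  | ComplexScalars => fun z : R[i] => Normc.normc z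
  end.

Definition of_real (R : realType) (F : scalar_kind) : R -> scalars R F :=
  match F with
  | RealScalars => fun a : R => a
  | ComplexScalars => fun a : R => (a%:C)%C
  end.

Definition scalar_measurable (R : realType) (F : scalar_kind)
    (disp : measure_display) (T : measurableType disp) :
    (T -> scalars R F) -> Prop :=
  match F with
  | RealScalars => fun f : T -> R => measurable_fun setT f
  | ComplexScalars => fun f : T -> R[i] =>
      measurable_fun setT (fun t => complex.Re (f t)) /\
      measurable_fun setT (fun t => complex.Im (f t))
  end.

Section Homogeneity.
Context (R : realType) (L : lmodType R) (disp : measure_display).
Context (T : measurableType disp) (C : cone_in L T).

Definition homogeneous_measure (mu : {measure set T -> \bar R}) (d : R) :=
  forall (c : R) (A : set T), 0 < c -> measurable A ->
    measurable (dil C c @` A) /\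
    mu (dil C c @` A) = ((c `^ d)%:E * mu A)%E.

Definition homogeneous_modulus (F : scalar_kind) (f : T -> scalars R F)
    (a : R) :=
  forall (c : R) t, 0 < c -> modulus (f (dil C c t)) = c `^ a * modulus (f t).

End Homogeneity.

Section LpSpaces.
Context (R : realType) (disp : measure_display) (T : measurableType disp).
Context (mu : {measure set T -> \bar R}) (F : scalar_kind).

Definition Lp_norm (p : R) (f : T -> scalars R F) : \bar R :=
  ('N[mu]_(p%:E) [(fun t => (modulus (f t))%:E)])%E.

(* L_p(T, mu) is handled through representatives; two functions represent the
   same element when they are equal almost everywhere. *)
Definition Lp (p : R) : set (T -> scalars R F) :=
  [set f | scalar_measurable f /\ (Lp_norm p f < +oo)%E].

(* An arbitrary map L_p(T, mu) -> L_q(T, mu): a map on representatives that is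
   well defined on almost-everywhere classes. *)
Definition recovery_method (p q : R)
    (m : (T -> scalars R F) -> (T -> scalars R F)) :=
  (forall y, Lp p y -> Lp q (m y)) /\
  (forall y z, Lp p y -> Lp p z -> y = z %[ae mu] -> m y = m z %[ae mu]).

End LpSpaces.

Section RecoveryProblem.
Context (R : realType) (disp : measure_display) (T : measurableType disp).
Context (mu : {measure set T -> \bar R}) (F : scalar_kind).
Context (n : nat) (psi : T -> scalars R F) (phi : 'I_n -> T -> scalars R F).
Context (p q r : R).

Definition domainW : set (T -> scalars R F) :=
  [set x | Lp mu p x /\
           forall j, (Lp_norm mu r (fun t => phi j t * x t)%R < +oo)%E].

Definition classW : set (T -> scalars R F) :=
  [set x | domainW x /\
           forall j, (Lp_norm mu r (fun t => phi j t * x t)%R <= 1)%E].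

Definition method_error (delta : R)
    (m : (T -> scalars R F) -> (T -> scalars R F)) : \bar R :=
  ereal_sup [set e | exists x y, [/\ classW x, Lp mu p y,
    (Lp_norm mu p (fun t => x t - y t)%R <= delta%:E)%E &
    e = Lp_norm mu q (fun t => psi t * x t - m y t)]].

Definition optimal_error (delta : R) : \bar R :=
  ereal_inf [set method_error delta m | m in recovery_method mu p q].

Definition optimal_method (delta : R)
    (m : (T -> scalars R F) -> (T -> scalars R F)) :=
  recovery_method mu p q m /\ method_error delta m = optimal_error delta.

End RecoveryProblem.

Definition in_P (R : realType) (p q r : R) := [&& 1 <= q, q < p & q < r].
Definition in_P1 (R : realType) (p q r : R) := [&& 1 <= q, q == r & r < p].
Definition in_P2 (R : realType) (p q r : R) := [&& 1 <= q, q == p & p < r].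

Section Weights.
Context (R : realType) (disp : measure_display) (T : measurableType disp).
Context (mu : {measure set T -> \bar R}) (F : scalar_kind).
Context (n : nat) (psi : T -> scalars R F) (phi : 'I_n -> T -> scalars R F).
Context (p q r : R).

Definition s_sum (a : R) (t : T) : R := \sum_(j < n) modulus (phi j t) `^ a.

(* For (p, q, r) in P the left-hand side increases from 0 to +oo as u runs over
   [0, 1), so exactly one u is selected. *)
Definition k_P (t : T) : R :=
  xget 0 [set u : R | 0 <= u < 1 /\
    u `^ (1 / (p - q)) / (1 - u) `^ (1 / (r - q)) =
    s_sum r t `^ (- (1 / (r - q))) *
    modulus (psi t) `^ (q * (p - r) / ((p - q) * (r - q)))].

Definition k_P1 (t : T) : R :=
  Num.max (1 - modulus (psi t) `^ (- q) * s_sum q t) 0.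

Definition k_P2 (t : T) : R := Num.min 1 (modulus (psi t) `^ (- p)).

(* P, P1 and P2 are disjoint; the last branch is meant for P2. *)
Definition k_fun (t : T) : R :=
  if in_P p q r then k_P t
  else if in_P1 p q r then k_P1 t
  else k_P2 t.

Definition I_psi : \bar R :=
  if in_P2 p q r then
    (\int[mu]_t
      (((s_sum r t)^-1 * Num.max (modulus (psi t) `^ p - 1) 0)
         `^ (p / (r - p)))%:E)%E
  else
    (\int[mu]_t
      (modulus (psi t) `^ (q * p / (p - q)) * k_fun t `^ (p / (p - q)))%:E)%E.

Definition I_phi (j : 'I_n) : \bar R :=
  if in_P2 p q r then
    (\int[mu]_t
      (modulus (phi j t) `^ r *
       ((s_sum r t)^-1 * Num.max (modulus (psi t) `^ p - 1) 0)
         `^ (r / (r - p)))%:E)%E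
  else
    (\int[mu]_t
      (modulus (psi t) `^ (q * r / (p - q)) * modulus (phi j t) `^ r *
       k_fun t `^ (r / (p - q)))%:E)%E.

End Weights.

(* Main.v *)
(** Write [a = |psi|], [b j = |phi j|] and [s = \sum_j b j ^ r].  In each of the
three parameter ranges there is a function [u >= 0] (the extremal function up to
scaling) splitting the weight [a^q] as
    [k a^q = u^(p - q)]   and   [(1 - k) a^q = s u^(r - q)]
wherever [u] is nonzero, with [<=] instead of [=] elsewhere.  The integrals [I1]
and [I2] are those of [u^p] and [(b j u)^r], and [a^q u^q = u^p + s u^r].  A
dilation [t |-> xi t] and a multiplication by a constant turn [u] into a function
[v] with [||v||_p = delta] and [||phi j v||_r = 1]; the splitting then holds for
[k (xi t)] up to constants [c1] and [c2], the Lagrange multipliers.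
Lower bound: [v] and [- v] are both compatible with the data [y = 0], so no method
has an error smaller than [||psi v||_q].
Upper bound: [psi x - k psi y = psi ((1 - k) x + k (x - y))], so by convexity the
error to the power [q] is at most the integral of
[(1 - k) a^q |x|^q + k a^q |x - y|^q].  Since the norms of [v] are normalized,
applying Young's inequality pointwise to [v^(p - q) |x - y|^q] and
[(b j v)^(r - q) (b j |x|)^q] loses nothing, and yields [||psi v||_q^q]. *)

Require Import Defs.
From HB Require Import structures.
From mathcomp Require Import all_boot all_order all_algebra.
From mathcomp Require Import all_classical all_reals all_analysis.
From mathcomp Require Import measurable_realfun complex.
From mathcomp Require Import ring lra.

Set Implicit Arguments.
Unset Strict Implicit.
Unset Printing Implicit Defensive.
Import Order.TTheory GRing.Theory Num.Theory.
Import numFieldNormedType.Exports.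
Local Open Scope classical_set_scope.
Local Open Scope ring_scope.

(** * The equation defining k on P *)

Section UnitRoot.
Context (R : realType).
Implicit Types (a b rho u w : R).

Lemma continuous_powR a (x : R) : 0 < x -> {for x, continuous ((@powR R)^~ a)}.
Proof.
move=> x0; apply/differentiable_continuous/derivable1_diffP/derivable_powR.
by rewrite in_itv/= x0.
Qed.

(** Without its denominator the equation reads [u^a - rho (1 - u)^b = 0]. The left-hand side is
    continuous on all of [[0, 1]] and goes from [- rho] to 1, so the intermediate value theorem
    applies. *)
Lemma unit_root_exists a b rho : 0 < a -> 0 < b -> 0 <= rho ->
  exists2 u, 0 <= u < 1 & u `^ a / (1 - u) `^ b = rho.
Proof.
move=> a0 b0 rho0; pose h u := u `^ a - rho * (1 - u) `^ b.
have h0 : h 0 = - rho by rewrite /h powR0 ?gt_eqF// subr0 powR1 mulr1 add0r.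
have h1 : h 1 = 1 by rewrite /h powR1 subrr powR0 ?gt_eqF// mulr0 subr0.
have cont1B (x : R) : {for x, continuous (fun y : R => 1 - y)}.
  by apply: cvgB; [exact: cvg_cst|exact: cvg_id].
have contpow1B (x : R) : x < 1 -> {for x, continuous (fun y : R => (1 - y) `^ b)}.
  move=> x1; apply: (@continuous_comp _ _ _ (fun y : R => 1 - y) ((@powR R)^~ b)).
    exact: cont1B.
  by apply: continuous_powR; rewrite subr_gt0.
have [||u] := @IVT R h 0 1 0 ler01.
- apply/continuous_within_itvP => //; split.
  + move=> x; rewrite in_itv/= => /andP[x0 x1].
    apply: cvgB; first exact: continuous_powR.
    by apply: cvgMr; exact: contpow1B.
  + rewrite /h; apply: cvgB.
      by rewrite powR0 ?gt_eqF//; exact: powR_cvg0.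
    by apply: cvgMr; apply: cvg_at_right_filter; exact: contpow1B.
  + rewrite /h; apply: cvgB.
      by apply: cvg_at_left_filter; exact: continuous_powR.
    apply: cvgMr; rewrite subrr powR0 ?gt_eqF//.
    (* As [y] tends to 1 from the left, [1 - y] tends to 0 through positive values, where
       [powR_cvg0] gives the limit of the power. *)
    apply: (@cvg_comp _ _ _ (fun y : R => 1 - y) ((@powR R)^~ b) _ (0^'+));
      last exact: powR_cvg0.
    move=> A [e /= e0 eA]; exists e => //= y ye y1.
    apply: eA; last by rewrite subr_gt0.
    by rewrite /= sub0r normrN.
- by rewrite h0 h1 ge_min le_max oppr_le0 rho0 ler01 orbT.
rewrite in_itv/= => /andP[u0 u1] hu.
(* The zero is not at 1, because [h 1 = 1]; hence the denominator can be restored. *)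
have {}u1 : u < 1.
  rewrite lt_neqAle u1 andbT; apply/eqP => u1'.
  by move: hu; rewrite u1' h1 => /eqP; rewrite oner_eq0.
exists u; first by rewrite u0 u1.
move/eqP: hu; rewrite subr_eq0 => /eqP ->; rewrite mulfK// gt_eqF// powR_gt0//.
by rewrite subr_gt0.
Qed.

Lemma unit_root_mono a b u w : 0 < a -> 0 < b -> 0 <= u < w -> w < 1 ->
  u `^ a / (1 - u) `^ b < w `^ a / (1 - w) `^ b.
Proof.
move=> a0 b0 /andP[u0 uw] w1.
have u1 := lt_trans uw w1; have w0 := le_lt_trans u0 uw.
rewrite ltr_pM ?invr_ge0 ?powR_ge0//.
  by rewrite gt0_ltr_powR// nnegrE// ltW.
rewrite ltf_pV2 ?posrE ?powR_gt0 ?subr_gt0//.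
by rewrite gt0_ltr_powR ?nnegrE ?subr_ge0 ?ltW// ltrD2l ltrN2.
Qed.

(** [k_P] is this function evaluated at the right-hand side of its equation. Isolating the
    dependence on [rho] reduces the measurability of the implicitly defined [k_P] to monotonicity in
    one real variable. *)
Definition unit_root a b rho : R :=
  xget 0 [set u : R | 0 <= u < 1 /\ u `^ a / (1 - u) `^ b = rho].

Lemma unit_rootP a b rho : 0 < a -> 0 < b -> 0 <= rho ->
  0 <= unit_root a b rho < 1 /\
  unit_root a b rho `^ a / (1 - unit_root a b rho) `^ b = rho.
Proof.
move=> a0 b0 rho0; rewrite /unit_root.
have [u u01 uE] := unit_root_exists a0 b0 rho0.
apply: (@xgetPex _ 0 [set u : R | 0 <= u < 1 /\ u `^ a / (1 - u) `^ b = rho]).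
by exists u.
Qed.

(** This is the inverse of the strictly increasing map of [unit_root_mono]. For negative [rho] the
    equation has no solution and the default value 0 is returned, which keeps the function monotone
    on the whole line. *)
Lemma unit_root_nondecreasing a b : 0 < a -> 0 < b ->
  {homo unit_root a b : x y / x <= y}.
Proof.
move=> a0 b0 x y xy; have [y0|y0] := ltP y 0.
  have xgetN z : z < 0 -> unit_root a b z = 0.
    move=> z0; rewrite /unit_root; case: xgetP => // u _ [_ uE].
    by move: z0; rewrite -uE ltNge mulr_ge0 ?invr_ge0 ?powR_ge0.
  by rewrite !xgetN// (le_lt_trans xy).
have [/andP[ky0 ky1] kyE] := unit_rootP a0 b0 y0.
have [x0|x0] := ltP x 0.
  rewrite {1}/unit_root; case: xgetP => // u _ [_ uE].
  by move: x0; rewrite -uE ltNge mulr_ge0 ?invr_ge0 ?powR_ge0.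
have [/andP[kx0 kx1] kxE] := unit_rootP a0 b0 x0.
rewrite leNgt; apply/negP => yx.
have : y < x by rewrite -kyE -kxE; apply: unit_root_mono => //; rewrite ky0.
by rewrite ltNge xy.
Qed.

Lemma measurable_unit_root a b : 0 < a -> 0 < b ->
  measurable_fun setT (unit_root a b).
Proof.
move=> a0 b0; apply: nondecreasing_measurable => //.
exact: unit_root_nondecreasing.
Qed.

End UnitRoot.

(** * Young's inequality and convexity of powers *)

Section RealInequalities.
Context (R : realType).
Implicit Types (a b k p q r u v x z : R).

(** Young's inequality with the conjugate exponents [p / (p - q)] and [p / q]; for [q = p], where
    the first is infinite, both sides agree. Equality also holds at [z = v], which makes the upper
    bound on the error sharp. *)
Lemma young_powR p q v z : 0 < q -> q <= p -> 0 <= v -> 0 <= z ->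
  v `^ (p - q) * z `^ q <= (1 - q / p) * v `^ p + q / p * z `^ p.
Proof.
move=> q0; rewrite le_eqVlt => /predU1P[<- v0 z0|qp v0 z0].
  by rewrite subrr powRr0 divff ?gt_eqF// subrr mul0r add0r.
have p0 := lt_trans q0 qp.
have pq0 : 0 < p - q by rewrite subr_gt0.
have := @conjugate_powR R (v `^ (p - q)) (z `^ q) (p / (p - q)) (p / q).
rewrite !powR_ge0 !divr_gt0// => /(_ isT isT isT isT) young.
apply: le_trans (young _) _.
  by field; rewrite !gt_eqF.
rewrite -!powRrM !(mulrC _ (p / _)) !divfK ?gt_eqF//.
rewrite lerD// mulrC ?invf_div.
  by rewrite mulrBl divff ?gt_eqF.
by rewrite mulrC.
Qed.

Lemma convex_powR_combination k q x z : 1 <= q -> 0 <= k <= 1 -> 0 <= x -> 0 <= z ->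
  ((1 - k) * x + k * z) `^ q <= (1 - k) * x `^ q + k * z `^ q.
Proof.
move=> q1 /andP[k0 k1] x0 z0.
have k01 : Itv.spec (@Itv.num_sem R) (Itv.Real `[0%Z, 1%Z]) k.
  by rewrite /Itv.num_sem/= in_itv/= k0 k1 ger0_real.
have := @convex_powR R q q1 (Itv.mk k01) z x.
rewrite !inE/= !in_itv/= !andbT => /(_ z0 x0).
rewrite [X in X `^ q <= _ -> _](_ : _ = k * z + (1 - k) * x)//.
by rewrite !convRE/= addrC [in X in _ <= X -> _]addrC.
Qed.

(** Distributing [b^r] over the two factors prepares [young_powR] for [b v] and [b x]. *)
Lemma powR_split_weight r q b v x : 0 < q -> q <= r -> 0 <= b -> 0 <= v -> 0 <= x ->
  b `^ r * v `^ (r - q) * x `^ q = (b * v) `^ (r - q) * (b * x) `^ q.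
Proof.
move=> q0 qr b0 v0 x0; have r0 := lt_le_trans q0 qr.
rewrite !powRM//; have [->|bn0] := eqVneq b 0.
  by rewrite [0 `^ r]powR0 ?[0 `^ q]powR0 ?gt_eqF// !(mul0r, mulr0).
rewrite -[in b `^ r](subrK q r) [b `^ (_ + q)]powRD ?bn0 ?implybT//.
ring.
Qed.

End RealInequalities.

(** * Moduli, integrals and L_p norms *)

Section Modulus.
Context (R : realType) (F : scalar_kind).
Implicit Types x y : scalars R F.

Lemma modulus_ge0 x : 0 <= modulus x.
Proof. by case: F x => [x|[a b]] /=; [exact: normr_ge0|exact: sqrtr_ge0]. Qed.

Lemma modulusM x y : modulus (x * y) = modulus x * modulus y.
Proof. by case: F x y => [x y|x y] /=; [exact: normrM|exact: Normc.normcM]. Qed.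

Lemma modulusN x : modulus (- x) = modulus x.
Proof. by case: F x => x /=; [exact: normrN|exact: normcN]. Qed.

Lemma ler_modulusD x y : modulus (x + y) <= modulus x + modulus y.
Proof. by case: F x y => [x y|x y] /=; [exact: ler_normD|exact: le_normcD]. Qed.

Lemma modulus_eq0 x : (modulus x == 0) = (x == 0).
Proof.
case: F x => [x|x] /=; first exact: normr_eq0.
by apply/eqP/eqP => [/Normc.eq0_normc//|->]; rewrite /= expr0n/= addr0 sqrtr0.
Qed.

Lemma modulus0 : modulus (0 : scalars R F) = 0.
Proof. by apply/eqP; rewrite modulus_eq0. Qed.

Lemma modulus_of_real (a : R) : modulus (of_real F a) = `|a|.
Proof. by case: F => //=; rewrite expr0n/= addr0 sqrtr_sqr. Qed.

Lemma of_real1 : of_real F (1 : R) = 1.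
Proof. by case: F. Qed.

Lemma of_realN (a : R) : of_real F (- a) = - of_real F a.
Proof. by case: F => //=; rewrite rmorphN. Qed.

Lemma of_realB (a b : R) : of_real F (a - b) = of_real F a - of_real F b.
Proof. by case: F => //=; rewrite rmorphB. Qed.

End Modulus.

Section ScalarMeasurable.
Context (R : realType) (F : scalar_kind) (disp : measure_display).
Context (T : measurableType disp).
Implicit Types f g : T -> scalars R F.

Lemma measurable_modulus f :
  scalar_measurable f -> measurable_fun setT (fun t => modulus (f t)).
Proof.
case: F f => f /=; first exact: measurableT_comp.
move=> [mRe mIm]; rewrite /Normc.normc.
rewrite (_ : (fun t => _) =
  (fun t => Num.sqrt (complex.Re (f t) ^+ 2 + complex.Im (f t) ^+ 2))); last first.
  by apply/funext => t; case: (f t).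
apply: (@measurableT_comp _ _ _ _ _ _ (@Num.sqrt R)).
  by apply: continuous_measurable_fun; exact: sqrt_continuous.
by apply: measurable_funD; exact: measurable_funX.
Qed.

Lemma measurable_powR_modulus a (f : T -> scalars R F) : scalar_measurable f ->
  measurable_fun setT (fun t => modulus (f t) `^ a).
Proof.
move=> mf; apply: (measurableT_comp (measurable_powR a)).
exact: measurable_modulus.
Qed.

Lemma scalar_measurableM f g :
  scalar_measurable f -> scalar_measurable g ->
  scalar_measurable (fun t => f t * g t).
Proof.
case: F f g => f g /=; first exact: measurable_funM.
move=> [mRf mIf] [mRg mIg]; split.
  rewrite (_ : (fun t => _) = (fun t => complex.Re (f t) * complex.Re (g t) -
      complex.Im (f t) * complex.Im (g t))); last first.
    by apply/funext => t; case: (f t) => ? ?; case: (g t).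
  by apply: measurable_funB; exact: measurable_funM.
rewrite (_ : (fun t => _) = (fun t => complex.Re (f t) * complex.Im (g t) +
    complex.Im (f t) * complex.Re (g t))); last first.
  by apply/funext => t; case: (f t) => ? ?; case: (g t).
by apply: measurable_funD; exact: measurable_funM.
Qed.

Lemma scalar_measurableD f g :
  scalar_measurable f -> scalar_measurable g ->
  scalar_measurable (fun t => f t + g t).
Proof.
case: F f g => f g /=; first exact: measurable_funD.
move=> [mRf mIf] [mRg mIg]; split.
  rewrite (_ : (fun t => _) = (fun t => complex.Re (f t) + complex.Re (g t))).
    exact: measurable_funD.
  by apply/funext => t; case: (f t) => ? ?; case: (g t).
rewrite (_ : (fun t => _) = (fun t => complex.Im (f t) + complex.Im (g t))).
  exact: measurable_funD.
by apply/funext => t; case: (f t) => ? ?; case: (g t).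
Qed.

Lemma scalar_measurable_of_real (f : T -> R) :
  measurable_fun setT f -> scalar_measurable (fun t => of_real F (f t)).
Proof. by case: F => //= mf; split => //; exact: measurable_cst. Qed.

Lemma scalar_measurable0 : scalar_measurable (fun _ : T => 0 : scalars R F).
Proof.
rewrite (_ : (fun _ => 0) = fun _ => of_real F (0 - 0 : R)).
  by apply: scalar_measurable_of_real; exact: measurable_cst.
by apply/funext => t; rewrite of_realB subrr.
Qed.

Lemma scalar_measurableB f g :
  scalar_measurable f -> scalar_measurable g ->
  scalar_measurable (fun t => f t - g t).
Proof.
move=> mf mg.
have mN1 : scalar_measurable (fun _ : T => of_real F (-1 : R)).
  by apply: scalar_measurable_of_real; exact: measurable_cst.
have := scalar_measurableD mf (scalar_measurableM mN1 mg).
congr scalar_measurable; apply/funext => t.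
by rewrite -[-1]sub0r of_realB of_real1 -[0]subr0 of_realB  !subrr sub0r mulN1r.
Qed.

End ScalarMeasurable.

Section RealIntegral.
Context (R : realType) (disp : measure_display) (T : measurableType disp).
Context (mu : {measure set T -> \bar R}).
Implicit Types f g : T -> R.

Lemma ge0_integral_EFinD f g : measurable_fun setT f -> measurable_fun setT g ->
  (forall t, 0 <= f t) -> (forall t, 0 <= g t) ->
  (\int[mu]_t (f t + g t)%:E = \int[mu]_t (f t)%:E + \int[mu]_t (g t)%:E)%E.
Proof.
move=> mf mg f0 g0; under eq_integral do rewrite EFinD.
by rewrite ge0_integralD//; do ?[by move=> t _; rewrite lee_fin];
  exact/measurable_EFinP.
Qed.

Lemma ge0_integral_EFinZl c f :
  measurable_fun setT f -> (forall t, 0 <= f t) -> 0 <= c ->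
  (\int[mu]_t (c * f t)%:E = c%:E * \int[mu]_t (f t)%:E)%E.
Proof.
move=> mf f0 c0; under eq_integral do rewrite EFinM.
by rewrite ge0_integralZl//; [exact/measurable_EFinP|move=> t _; rewrite lee_fin].
Qed.

Lemma ge0_integral_EFin_sum n (f : 'I_n -> T -> R) :
  (forall j, measurable_fun setT (f j)) -> (forall j t, 0 <= f j t) ->
  (\int[mu]_t (\sum_(j < n) f j t)%:E = \sum_(j < n) \int[mu]_t (f j t)%:E)%E.
Proof.
move=> mf f0; under eq_integral do rewrite -sumEFin.
by rewrite ge0_integral_sum//;
  [move=> j; exact/measurable_EFinP|move=> j t _; rewrite lee_fin].
Qed.

Lemma ae_ge0_le_integral_EFin f g :
  measurable_fun setT f -> measurable_fun setT g ->
  (forall t, 0 <= f t) -> (forall t, 0 <= g t) -> {ae mu, forall t, f t <= g t} ->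
  (\int[mu]_t (f t)%:E <= \int[mu]_t (g t)%:E)%E.
Proof.
move=> mf mg f0 g0 fg; apply: ae_ge0_le_integral => //;
  do ?[by move=> t _; rewrite lee_fin]; do ?exact/measurable_EFinP.
by apply: filterS fg => t fgt _; rewrite lee_fin.
Qed.

End RealIntegral.

Section LpNorm.
Context (R : realType) (disp : measure_display) (T : measurableType disp).
Context (mu : {measure set T -> \bar R}) (F : scalar_kind).
Implicit Types f : T -> scalars R F.

Lemma Lp_normE p f :
  Lp_norm mu p f = ((\int[mu]_t (modulus (f t) `^ p)%:E) `^ p^-1)%E.
Proof.
rewrite /Lp_norm unlock; congr (_ `^ _)%E; apply: eq_integral => t _.
by rewrite abse_EFin poweR_EFin ger0_norm ?modulus_ge0.
Qed.

(** Since [x^p] is increasing on [[0, +oo]], norm bounds can be handled as bounds on integrals of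
    powers, which add up. *)
Lemma Lp_norm_le p f (A : R) : 0 < p -> 0 <= A ->
  (Lp_norm mu p f <= A%:E)%E =
  (\int[mu]_t (modulus (f t) `^ p)%:E <= (A `^ p)%:E)%E.
Proof.
move=> p0 A0; rewrite Lp_normE; set J := (\int[mu]_t _)%E.
have J0 : (0 <= J)%E by apply: integral_ge0 => t _; rewrite lee_fin powR_ge0.
have E (x : \bar R) : (0 <= x)%E -> ((x `^ p^-1) `^ p)%E = x.
  by move=> x0; rewrite -poweRrM mulVf ?gt_eqF// poweRe1.
have E' : ((A `^ p)%:E `^ p^-1)%E = A%:E.
  by rewrite poweR_EFin -powRrM divff ?gt_eqF// powRr1.
apply/idP/idP => [|] H.
  rewrite -(E _ J0) -poweR_EFin; apply: gt0_ler_poweR => //; first exact: ltW.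
  - by rewrite in_itv/= leey poweR_ge0.
  - by rewrite in_itv/= leey lee_fin A0.
rewrite -E'; apply: gt0_ler_poweR => //; first by rewrite invr_ge0 ltW.
- by rewrite in_itv/= leey J0.
- by rewrite in_itv/= leey lee_fin powR_ge0.
Qed.

Lemma Lp_norm_eq p f (A : R) : 0 < p -> 0 <= A ->
  (\int[mu]_t (modulus (f t) `^ p)%:E = (A `^ p)%:E)%E -> Lp_norm mu p f = A%:E.
Proof.
move=> p0 A0 fA; rewrite Lp_normE fA poweR_EFin -powRrM divff ?gt_eqF//.
by rewrite powRr1.
Qed.

Lemma Lp_norm_lty p f : 0 < p ->
  (Lp_norm mu p f < +oo)%E = (\int[mu]_t (modulus (f t) `^ p)%:E < +oo)%E.
Proof.
move=> p0; rewrite Lp_normE; apply/idP/idP; last exact: poweR_lty.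
by apply: lty_poweRy; rewrite gt_eqF ?invr_gt0.
Qed.

End LpNorm.

(** * Optimality from the Lagrange conditions *)

Section MultiplierMethod.
Context (R : realType) (disp : measure_display) (T : measurableType disp).
Context (mu : {measure set T -> \bar R}) (F : scalar_kind).
Context (n : nat) (psi : T -> scalars R F) (phi : 'I_n -> T -> scalars R F).
Context (p q r c1 c2 : R) (k v : T -> R).
Hypothesis mpsi : scalar_measurable psi.
Hypothesis mphi : forall j, scalar_measurable (phi j).
Hypothesis mk : measurable_fun setT k.
Hypothesis mv : measurable_fun setT v.
Hypothesis k01 : forall t, 0 <= k t <= 1.
Hypothesis v0 : forall t, 0 <= v t.
Hypothesis q1 : 1 <= q.
Hypothesis qp : q <= p.
Hypothesis qr : q <= r.
Hypothesis c1_ge0 : 0 <= c1.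
Hypothesis c2_ge0 : 0 <= c2.
Hypothesis k_le : forall t, k t * modulus (psi t) `^ q <= c1 * v t `^ (p - q).
Hypothesis kC_le : {ae mu, forall t,
  (1 - k t) * modulus (psi t) `^ q <= c2 * s_sum phi r t * v t `^ (r - q)}.

Let q0 : 0 < q. Proof. exact: lt_le_trans ltr01 q1. Qed.
Let p0 : 0 < p. Proof. exact: lt_le_trans q0 qp. Qed.
Let r0 : 0 < r. Proof. exact: lt_le_trans q0 qr. Qed.

Definition multiplier_method (y : T -> scalars R F) (t : T) : scalars R F :=
  of_real F (k t) * psi t * y t.

Lemma modulus_residual_le t (x y : scalars R F) :
  modulus (psi t * x - of_real F (k t) * psi t * y) <=
  modulus (psi t) * ((1 - k t) * modulus x + k t * modulus (x - y)).
Proof.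
have /andP[k0 k1] := k01 t.
have -> : psi t * x - of_real F (k t) * psi t * y =
    psi t * (of_real F (1 - k t) * x + of_real F (k t) * (x - y)).
  rewrite of_realB of_real1; ring.
rewrite modulusM ler_wpM2l ?modulus_ge0//.
apply: le_trans (ler_modulusD _ _) _.
by rewrite !modulusM !modulus_of_real !ger0_norm// subr_ge0.
Qed.

(** Here [z] stands for [x - y]. The two weights in each bracket add up to 1, so norms of [x] and
    [z] within the constraints give an integral of at most [n c2 + c1 delta^p]. *)
Definition Young_majorant (x z : T -> scalars R F) (t : T) : R :=
  c2 * \sum_(j < n) ((1 - q / r) * (modulus (phi j t) * v t) `^ r +
    q / r * modulus (phi j t * x t) `^ r) +
  c1 * ((1 - q / p) * v t `^ p + q / p * modulus (z t) `^ p).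

(** The exceptional set is that of [kC_le], hence the same for all [x] and [y]. *)
Lemma residual_powR_le : {ae mu, forall t, forall x y : T -> scalars R F,
  modulus (psi t * x t - multiplier_method y t) `^ q <=
  Young_majorant x (fun t => x t - y t) t}.
Proof.
apply: filterS kC_le => t kC x y; have /andP[k0 k1] := k01 t.
set X := modulus (x t); set Z := modulus (x t - y t).
have X0 : 0 <= X := modulus_ge0 _; have Z0 : 0 <= Z := modulus_ge0 _.
have kC0 : 0 <= 1 - k t by rewrite subr_ge0.
have E0 : 0 <= (1 - k t) * X + k t * Z by rewrite addr_ge0// mulr_ge0.
apply: (@le_trans _ _ ((modulus (psi t) * ((1 - k t) * X + k t * Z)) `^ q)).
  rewrite ge0_ler_powR ?nnegrE ?modulus_ge0 ?mulr_ge0 ?modulus_ge0 ?(ltW q0)//.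
  exact: modulus_residual_le.
rewrite powRM ?modulus_ge0//.
(* Convexity of the [q]-th power with weights [1 - k t] and [k t]. *)
apply: (@le_trans _ _ ((1 - k t) * modulus (psi t) `^ q * X `^ q +
    k t * modulus (psi t) `^ q * Z `^ q)).
  rewrite -!mulrA (mulrCA (1 - k t)) (mulrCA (k t)) -mulrDr.
  by rewrite ler_wpM2l ?powR_ge0// convex_powR_combination.
(* The term in [X] is controlled by [kC_le] and Young's inequality for each [j], the term in [Z] by
   [k_le] and Young's inequality. *)
apply: lerD.
  apply: (@le_trans _ _ (c2 * s_sum phi r t * v t `^ (r - q) * X `^ q)).
    by rewrite ler_wpM2r ?powR_ge0.
  rewrite -!mulrA ler_wpM2l// /s_sum mulr_suml; apply: ler_sum => j _.
  rewrite mulrA powR_split_weight ?modulus_ge0// modulusM.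
  by apply: young_powR; rewrite ?mulr_ge0 ?modulus_ge0.
apply: (@le_trans _ _ (c1 * v t `^ (p - q) * Z `^ q)).
  by rewrite ler_wpM2r ?powR_ge0.
by rewrite -mulrA ler_wpM2l// young_powR.
Qed.

Lemma scalar_measurable_multiplier y : scalar_measurable y ->
  scalar_measurable (multiplier_method y).
Proof.
move=> my; apply: scalar_measurableM => //; apply: scalar_measurableM => //.
exact: scalar_measurable_of_real.
Qed.

(** This serves twice: with [x = 0] to show that the method maps into L_q, and with [x] in W to
    bound its error. All integrands are nonnegative, so the bound makes sense in the extended reals
    without integrability. *)
Lemma integral_residual_le (x y : T -> scalars R F) :
  scalar_measurable x -> scalar_measurable y ->
  (\int[mu]_t (modulus (psi t * x t - multiplier_method y t) `^ q)%:E <=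
   c2%:E * \sum_(j < n) ((1 - q / r)%:E *
       \int[mu]_t ((modulus (phi j t) * v t) `^ r)%:E +
     (q / r)%:E * \int[mu]_t (modulus (phi j t * x t) `^ r)%:E) +
   c1%:E * ((1 - q / p)%:E * \int[mu]_t (v t `^ p)%:E +
     (q / p)%:E * \int[mu]_t (modulus (x t - y t) `^ p)%:E))%E.
Proof.
move=> mx my.
have qr0 : 0 <= q / r by rewrite divr_ge0// ltW.
have qp0 : 0 <= q / p by rewrite divr_ge0// ltW.
have qrC0 : 0 <= 1 - q / r by rewrite subr_ge0 ler_pdivrMr// mul1r.
have qpC0 : 0 <= 1 - q / p by rewrite subr_ge0 ler_pdivrMr// mul1r.
have mbv j : measurable_fun setT (fun t => (modulus (phi j t) * v t) `^ r).
  apply: (measurableT_comp (measurable_powR r)).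
  by apply: measurable_funM => //; exact: measurable_modulus.
have mbx j : measurable_fun setT (fun t => modulus (phi j t * x t) `^ r).
  by apply: measurable_powR_modulus; exact: scalar_measurableM.
have mvp : measurable_fun setT (fun t => v t `^ p).
  exact: (measurableT_comp (measurable_powR p)).
have mz : measurable_fun setT (fun t => modulus (x t - y t) `^ p).
  by apply: measurable_powR_modulus; exact: scalar_measurableB.
have mcst a (f : T -> R) :
    measurable_fun setT f -> measurable_fun setT (fun t => a * f t).
  by move=> mf; apply: measurable_funM.
pose f j t := (1 - q / r) * (modulus (phi j t) * v t) `^ r +
  q / r * modulus (phi j t * x t) `^ r.
pose g t := (1 - q / p) * v t `^ p + q / p * modulus (x t - y t) `^ p.
have f0 j t : 0 <= f j t by rewrite addr_ge0// mulr_ge0// powR_ge0.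
have g0 t : 0 <= g t by rewrite addr_ge0// mulr_ge0// powR_ge0.
have mf j : measurable_fun setT (f j) by apply: measurable_funD; exact: mcst.
have mg : measurable_fun setT g by apply: measurable_funD; exact: mcst.
have sf0 t : 0 <= \sum_(j < n) f j t by rewrite sumr_ge0.
have msf : measurable_fun setT (fun t => \sum_(j < n) f j t).
  exact: measurable_sum.
have fE j : (\int[mu]_t (f j t)%:E = (1 - q / r)%:E *
       \int[mu]_t ((modulus (phi j t) * v t) `^ r)%:E +
     (q / r)%:E * \int[mu]_t (modulus (phi j t * x t) `^ r)%:E)%E.
  by rewrite ge0_integral_EFinD ?ge0_integral_EFinZl//;
    first [exact: mcst | by move=> t; exact: powR_ge0 |
           by move=> t; apply: mulr_ge0 => //; exact: powR_ge0].
have gE : (\int[mu]_t (g t)%:E = (1 - q / p)%:E * \int[mu]_t (v t `^ p)%:E +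
     (q / p)%:E * \int[mu]_t (modulus (x t - y t) `^ p)%:E)%E.
  by rewrite ge0_integral_EFinD ?ge0_integral_EFinZl//;
    first [exact: mcst | by move=> t; exact: powR_ge0 |
           by move=> t; apply: mulr_ge0 => //; exact: powR_ge0].
under [X in (_ <= _ * X + _)%E]eq_bigr do rewrite -fE.
rewrite -gE -ge0_integral_EFin_sum// -!ge0_integral_EFinZl//.
rewrite -ge0_integral_EFinD//; do ?[by move=> t; rewrite mulr_ge0]; do ?exact: mcst.
apply: ae_ge0_le_integral_EFin.
- apply: measurable_powR_modulus; apply: scalar_measurableB.
    exact: scalar_measurableM.
  exact: scalar_measurable_multiplier.
- by apply: measurable_funD; exact: mcst.
- by move=> t; exact: powR_ge0.
- by move=> t; rewrite addr_ge0// mulr_ge0.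
- by apply: filterS residual_powR_le => t; exact.
Qed.

Context (delta : R).
Hypothesis delta_gt0 : 0 < delta.
Hypothesis int_v : (\int[mu]_t (v t `^ p)%:E = (delta `^ p)%:E)%E.
Hypothesis int_phi_v : forall j,
  (\int[mu]_t ((modulus (phi j t) * v t) `^ r)%:E = 1)%E.
Hypothesis stationarity : forall t,
  modulus (psi t) `^ q * v t `^ q = c1 * v t `^ p + c2 * s_sum phi r t * v t `^ r.

(** This is [||psi v||_q], as [integral_extremal_image] shows. *)
Let value := (c1 * delta `^ p + n%:R * c2) `^ (1 / q).

(** For [x = 0] the residual is [- k psi y], so [integral_residual_le] bounds it by the integrals of
    [v] and [y]. The method acts pointwise and therefore respects equality almost everywhere. *)
Lemma multiplier_method_recovery : recovery_method mu p q multiplier_method.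
Proof.
split=> [y [my ylty]|y z _ _]; last first.
  by apply: filterS => t yz /yz /=; rewrite /multiplier_method => ->.
split; first exact: scalar_measurable_multiplier.
rewrite Lp_norm_lty//; rewrite Lp_norm_lty// in ylty.
have := integral_residual_le (@scalar_measurable0 R F _ T) my.
under eq_integral do rewrite mulr0 sub0r modulusN.
move=> /le_lt_trans; apply.
under [X in (_ + _ * (_ + _ * X) < _)%E]eq_integral do rewrite sub0r modulusN.
(* The integral of [|y|^p] is finite; written as a real number it makes the whole bound real. *)
rewrite -[X in (_ + _ * (_ + _ * X) < _)%E]fineK; last first.
  by rewrite ge0_fin_numE//; apply: integral_ge0 => t _; rewrite lee_fin powR_ge0.
under eq_bigr => j _.
  rewrite int_phi_v; under eq_integral do rewrite mulr0 modulus0 powR0 ?gt_eqF//.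
  rewrite integral0 mule0 mule1 adde0.
  over.
by rewrite sumEFin int_v -!(EFinM, EFinD) ltry.
Qed.

Lemma multiplier_method_error_le :
  (method_error mu psi phi p q r delta multiplier_method <= value%:E)%E.
Proof.
have value0 : 0 <= c1 * delta `^ p + n%:R * c2.
  by rewrite addr_ge0 ?mulr_ge0 ?powR_ge0.
apply: ge_ereal_sup => e [x [y [[[[mx _] _] xW] [my _] xy ->]]].
rewrite Lp_norm_le ?powR_ge0//; rewrite Lp_norm_le ?(ltW delta_gt0)// in xy.
rewrite -powRrM div1r mulVf ?gt_eqF// powRr1//.
apply: le_trans (integral_residual_le mx my) _.
rewrite int_v [X in (_ <= X%:E)%E]addrC.
have qr0 : 0 <= q / r by rewrite divr_ge0// ltW.
have qp0 : 0 <= q / p by rewrite divr_ge0// ltW.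
rewrite [leRHS]EFinD; apply: leeD.
  rewrite [n%:R * _]mulrC [leRHS]EFinM lee_wpmul2l ?lee_fin//.
  (* Each unit of [n] is split into the two Young weights, so that the comparison goes term by
     term. *)
  have -> : n%:R%:E = (\sum_(j < n) ((1 - q / r)%:E + (q / r)%:E))%E.
    by rewrite -EFinD subrK sumEFin sumr_const card_ord.
  apply: lee_sum => j _; rewrite int_phi_v mule1 leeD2l//.
  rewrite -[leRHS]mule1 lee_wpmul2l//.
  by have := xW j; rewrite Lp_norm_le// powR1.
rewrite [leRHS]EFinM lee_wpmul2l ?lee_fin//.
rewrite [leRHS](_ : _ = (1 - q / p)%:E * (delta `^ p)%:E +
  (q / p)%:E * (delta `^ p)%:E)%E; last by rewrite -!EFinM -EFinD; congr EFin; ring.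
by rewrite leeD2l// lee_wpmul2l.
Qed.

Let xhat (t : T) : scalars R F := of_real F (v t).

(** Integrating [stationarity] leaves [c1] times the integral of [v^p], plus [c2] once for each
    [j]. *)
Lemma integral_extremal_image :
  (\int[mu]_t (modulus (psi t * xhat t) `^ q)%:E =
   (c1 * delta `^ p + n%:R * c2)%:E)%E.
Proof.
have mvp : measurable_fun setT (fun t => v t `^ p).
  exact: (measurableT_comp (measurable_powR p)).
have mbv j : measurable_fun setT (fun t => (modulus (phi j t) * v t) `^ r).
  apply: (measurableT_comp (measurable_powR r)).
  by apply: measurable_funM => //; exact: measurable_modulus.
have msbv : measurable_fun setT
    (fun t => \sum_(j < n) (modulus (phi j t) * v t) `^ r).
  exact: measurable_sum.
have sbv0 t : 0 <= \sum_(j < n) (modulus (phi j t) * v t) `^ r.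
  by apply: sumr_ge0 => j _; exact: powR_ge0.
under eq_integral => t _.
  rewrite modulusM modulus_of_real ger0_norm// powRM ?modulus_ge0// stationarity.
  rewrite -mulrA /s_sum mulr_suml.
  under eq_bigr do rewrite -powRM ?modulus_ge0//.
  over.
rewrite ge0_integral_EFinD//; first last.
- by move=> t; rewrite mulr_ge0.
- by move=> t; rewrite mulr_ge0 ?powR_ge0.
- exact: measurable_funM.
- exact: measurable_funM.
rewrite !ge0_integral_EFinZl//; last by move=> t; exact: powR_ge0.
rewrite ge0_integral_EFin_sum//; last by move=> j t; exact: powR_ge0.
under eq_bigr do rewrite int_phi_v.
by rewrite sumEFin sumr_const card_ord int_v -!EFinM -EFinD (mulrC n%:R).
Qed.

(** The sign [s] covers [v] and [- v] at once; the difference with 0 is the distance to the zero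
    data, in the form used by [method_error]. *)
Lemma extremal_classW (s : R) : `|s| = 1 ->
  classW mu phi p r (fun t => of_real F s * xhat t) /\
  Lp_norm mu p (fun t => of_real F s * xhat t - 0) = delta%:E.
Proof.
move=> s1.
have E (x : scalars R F) : modulus (of_real F s * x) = modulus x.
  by rewrite modulusM modulus_of_real s1 mul1r.
have ms : scalar_measurable (fun t => of_real F s * xhat t).
  by apply: scalar_measurableM; apply: scalar_measurable_of_real.
have Np : Lp_norm mu p (fun t => of_real F s * xhat t) = delta%:E.
  apply: Lp_norm_eq => //; first exact: ltW.
  by under eq_integral do rewrite E modulus_of_real ger0_norm//.
have Nr j : Lp_norm mu r (fun t => phi j t * (of_real F s * xhat t)) = 1%:E.
  apply: Lp_norm_eq => //; rewrite powR1.
  under eq_integral do rewrite modulusM E modulus_of_real ger0_norm//.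
  exact: int_phi_v.
split; last by rewrite -Np; congr Lp_norm; apply/funext => t; rewrite subr0.
split; last by move=> j; rewrite Nr.
split; last by move=> j; rewrite Nr ltry.
by split => //; rewrite Np ltry.
Qed.

(* [v] and [- v] both lie in W and at distance [delta] from the data [0]. *)
Lemma method_error_ge m : recovery_method mu p q m ->
  (value%:E <= method_error mu psi phi p q r delta m)%E.
Proof.
move=> [mLq _]; set e := method_error _ _ _ _ _ _ _ _.
pose y0 : T -> scalars R F := fun=> 0.
have y0Lp : Lp mu p y0.
  split; first exact: scalar_measurable0.
  rewrite Lp_norm_lty//.
  under eq_integral do rewrite modulus0 powR0 ?gt_eqF//.
  by rewrite integral0.
have [mm _] := mLq _ y0Lp.
have le_e (s : R) : `|s| = 1 ->
    (Lp_norm mu q (fun t => psi t * (of_real F s * xhat t) - m y0 t)%R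
     <= e)%E.
  move=> /extremal_classW[sW sN]; apply: ereal_sup_ubound.
  by exists (fun t => of_real F s * xhat t), y0; split => //; rewrite sN.
have e0 : (0 <= e)%E.
  by apply: le_trans (le_e 1 (@normr1 R)); exact: Lnorm_ge0.
(* Only a finite error needs an argument. *)
case: e e0 le_e => [e e0 le_e|_ _|//]; last by rewrite leey.
rewrite lee_fin in e0.
have mxhat : scalar_measurable (fun t => psi t * xhat t).
  by apply: scalar_measurableM => //; exact: scalar_measurable_of_real.
have mres (s : R) : measurable_fun setT
    (fun t => modulus (psi t * (of_real F s * xhat t) - m y0 t) `^ q).
  apply: measurable_powR_modulus; apply: scalar_measurableB => //.
  apply: scalar_measurableM => //; apply: scalar_measurableM.
    by apply: scalar_measurable_of_real; exact: measurable_cst.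
  exact: scalar_measurable_of_real.
have : (\int[mu]_t (modulus (psi t * xhat t) `^ q)%:E <= (e `^ q)%:E)%E.
  (* With [X] and [Y] the residuals for [v] and [- v], the unknown [m y0] cancels in
     [psi v = (X - Y) / 2]; convexity then bounds [|psi v|^q] by the mean of [|X|^q] and [|Y|^q]. *)
  apply: (@le_trans _ _ (\int[mu]_t (2^-1 *
      modulus (psi t * (of_real F 1 * xhat t) - m y0 t) `^ q +
    2^-1 * modulus (psi t * (of_real F (-1) * xhat t) - m y0 t) `^ q)%:E)%E).
    apply: ae_ge0_le_integral_EFin.
    - exact: measurable_powR_modulus.
    - by apply: measurable_funD; apply: measurable_funM.
    - by move=> t; exact: powR_ge0.
    - by move=> t; rewrite addr_ge0// mulr_ge0 ?powR_ge0.
    - apply: aeW => t; set X := _ - _; set Y := _ - _.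
      have hh : 1 - 2^-1 = 2^-1 :> R by lra.
      (* Compatibility of [of_real] with 1 and subtraction yields that its two halves sum to 1. *)
      have hE : of_real F (2^-1 : R) = 1 - of_real F 2^-1.
        by rewrite -[in LHS]hh of_realB of_real1.
      have -> : psi t * xhat t = of_real F 2^-1 * X + of_real F 2^-1 * - Y.
        rewrite (_ : _ + _ = (of_real F 2^-1 + of_real F 2^-1) * (psi t * xhat t)).
          by rewrite [X in X + _]hE subrK mul1r.
        by rewrite /X /Y of_realN of_real1; ring.
      apply: (@le_trans _ _ (((1 - 2^-1) * modulus X + 2^-1 * modulus Y) `^ q)).
        rewrite hh ge0_ler_powR ?nnegrE ?modulus_ge0 ?(ltW q0)//.
          by rewrite addr_ge0// mulr_ge0 ?modulus_ge0.
        apply: le_trans (ler_modulusD _ _) _.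
        by rewrite !modulusM modulusN modulus_of_real ger0_norm.
      have := @convex_powR_combination _ 2^-1 q _ _ q1 _
        (modulus_ge0 X) (modulus_ge0 Y).
      by rewrite hh; apply; rewrite invr_ge0 ler0n invf_le1// ler1n.
  rewrite ge0_integral_EFinD; first last.
  - by move=> t; rewrite mulr_ge0 ?powR_ge0.
  - by move=> t; rewrite mulr_ge0 ?powR_ge0.
  - exact: measurable_funM.
  - exact: measurable_funM.
  rewrite !ge0_integral_EFinZl//; do ?[by move=> t; exact: powR_ge0].
  rewrite [leRHS](_ : _ = 2^-1%:E * (e `^ q)%:E + 2^-1%:E * (e `^ q)%:E)%E.
    by apply: leeD; rewrite lee_wpmul2l// -Lp_norm_le//;
      apply: le_e; rewrite ?normrN normr1.
  by rewrite -!EFinM -EFinD; congr EFin; lra.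
rewrite integral_extremal_image !lee_fin => le_eq.
apply: le_trans (ge0_ler_powR _ _ _ le_eq) _; rewrite ?nnegrE ?powR_ge0//.
- by rewrite div1r invr_ge0 ltW.
- by rewrite addr_ge0 ?mulr_ge0 ?powR_ge0.
- by rewrite -powRrM div1r mulfV ?gt_eqF// powRr1.
Qed.

Lemma optimal_multiplier_method :
  optimal_error mu psi phi p q r delta = value%:E /\
  optimal_method mu psi phi p q r delta multiplier_method.
Proof.
have errE : method_error mu psi phi p q r delta multiplier_method = value%:E.
  apply/eqP; rewrite eq_le multiplier_method_error_le.
  by rewrite method_error_ge//; exact: multiplier_method_recovery.
have optE : optimal_error mu psi phi p q r delta = value%:E.
  apply/eqP; rewrite eq_le; apply/andP; split; last first.
    by apply: le_ereal_inf_tmp => _ [m hm <-]; exact: method_error_ge.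
  apply: ge_ereal_inf; exists value%:E => //; exists multiplier_method => //.
  exact: multiplier_method_recovery.
split=> //; split; first exact: multiplier_method_recovery.
by rewrite errE optE.
Qed.

End MultiplierMethod.

(** * Dilations *)

Section Dilation.
Context (R : realType) (L : lmodType R) (disp : measure_display).
Context (T : measurableType disp) (C : cone_in L T).
Context (mu : {measure set T -> \bar R}) (d : R).
Hypothesis hom_mu : homogeneous_measure C mu d.

Lemma dilK c : 0 < c -> cancel (dil C c) (dil C c^-1).
Proof.
move=> c0 t; apply: (@incl_inj _ _ _ C).
by rewrite !dilE ?invr_gt0// scalerA mulVf ?gt_eqF// scale1r.
Qed.

(** Homogeneity of the measure concerns images, whereas measurability and pushforwards concern
    preimages. *)
Lemma dil_preimage c (A : set T) : 0 < c -> dil C c @^-1` A = dil C c^-1 @` A.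
Proof.
move=> c0; apply/seteqP; split=> [t At|_ [t At <-]] /=.
  by exists (dil C c t) => //; exact: dilK.
by rewrite -{1}(invrK c) dilK ?invr_gt0.
Qed.

Lemma measurable_dil c : 0 < c -> measurable_fun setT (dil C c).
Proof.
move=> c0 _ A mA; rewrite setTI dil_preimage//.
by apply: (hom_mu _ mA).1; rewrite invr_gt0.
Qed.

(** Change of variables: the pushforward of [mu] under [dil c] is [c^(- d) mu], the sign coming from
    the inverse dilation in [dil_preimage]. *)
Lemma integral_dil c (f : T -> R) : 0 < c -> measurable_fun setT f ->
  (forall t, 0 <= f t) ->
  (\int[mu]_t (f (dil C c t))%:E = (c `^ (- d))%:E * \int[mu]_t (f t)%:E)%E.
Proof.
move=> c0 mf f0.
have mfE : measurable_fun setT (EFin \o f) by exact/measurable_EFinP.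
transitivity (\int[pushforward mu (dil C c)]_t (f t)%:E)%E.
  rewrite (@ge0_integral_pushforward _ _ _ _ _ _ (measurable_dil c0) mu setT
    (EFin \o f))//.
  by move=> t _; rewrite lee_fin.
rewrite [LHS](eq_measure_integral (mscale (NngNum (powR_ge0 c (- d))) mu)).
  rewrite ge0_integral_mscale//.
  by move=> t _; rewrite lee_fin.
  exact: measurable_dil.
move=> md A mA _; rewrite /= /pushforward dil_preimage//.
rewrite (hom_mu _ mA).2 ?invr_gt0//.
rewrite /mscale/=; congr (_%:E * _)%E.
by rewrite -powR_inv1 ?ltW// -powRrM mulN1r.
Qed.

End Dilation.

(* With [v t = A * u (xi t)], the first two identities say that [||v||_p = delta] and
[||phi j v||_r = 1]; the other two evaluate [c1 delta^p] and [c2]. *)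
Lemma scaling_constants (R : realType) (d eta nu p q r delta I1 I2 : R) :
  0 < p -> 0 < q -> 0 < r -> 0 < delta -> 0 < I1 -> 0 < I2 ->
  nu + d * (1 / r - 1 / p) != 0 ->
  let gamma := (nu - eta - d * (1 / q - 1 / r)) / (nu + d * (1 / r - 1 / p)) in
  let xi := (delta * I1 `^ (- (1 / p)) * I2 `^ (1 / r))
              `^ (1 / (nu + d * (1 / r - 1 / p))) in
  let A := delta * I1 `^ (- (1 / p)) * xi `^ (d / p) in
  let V := delta `^ gamma * I1 `^ (- (gamma / p)) * I2 `^ (- ((1 - gamma) / r)) in
  [/\ A `^ p * (xi `^ (- d) * I1) = delta `^ p,
      (xi `^ (- nu) * A) `^ r * (xi `^ (- d) * I2) = 1,
      xi `^ (- (eta * q)) * A `^ (q - p) * delta `^ p = V `^ q * I1 &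
      xi `^ (nu * r - eta * q) * A `^ (q - r) = V `^ q * I2].
Proof.
move=> p0 q0 r0 d0 i1 i2 nondeg gamma xi A V.
pose D := nu + d * (1 / r - 1 / p); have D0 : D != 0 := nondeg.
have xi0 : 0 < xi by rewrite /xi powR_gt0// !mulr_gt0 ?powR_gt0.
have lnxi : ln xi = D^-1 * (ln delta - ln I1 / p + ln I2 / r).
  rewrite /xi ln_powR -/D !lnM ?posrE ?mulr_gt0 ?powR_gt0// !ln_powR; field.
  by rewrite D0 !gt_eqF.
have A0 : 0 < A by exact: mulr_gt0 (mulr_gt0 d0 (powR_gt0 _ i1)) (powR_gt0 _ xi0).
clearbody xi.
have lnA : ln A = ln delta - ln I1 / p + d / p * ln xi.
  rewrite /A !lnM ?posrE ?mulr_gt0 ?powR_gt0// !ln_powR; field.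
  by rewrite !gt_eqF.
clearbody A.
have V0 : 0 < V by rewrite /V !mulr_gt0 ?powR_gt0.
have lnV : ln V = gamma * (ln delta - ln I1 / p) - (1 - gamma) / r * ln I2.
  rewrite /V !lnM ?posrE ?mulr_gt0 ?powR_gt0// !ln_powR; field.
  by rewrite !gt_eqF.
clearbody V.
have xiA0 : 0 < xi `^ (- nu) * A by rewrite mulr_gt0 ?powR_gt0.
(* All quantities are positive, so the four identities are checked on logarithms, where they are
   linear in [ln delta], [ln I1] and [ln I2], with coefficients rational in the exponents. *)
have eqln x y : 0 < x -> 0 < y -> ln x = ln y -> x = y.
  by move=> x0 y0 xy; apply: ln_inj.
(* The nondegeneracy condition with denominators cleared, in the form [field] asks for. *)
have Drp : nu * (r * p) + d * (p + -1 * r) != 0.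
  rewrite (_ : _ + _ = D * (r * p)).
    by rewrite mulf_neq0// mulf_neq0// gt_eqF.
  by rewrite /D; field; rewrite !gt_eqF.
by split; apply: eqln;
  rewrite ?ln1 ?(lnM, ln_powR) ?posrE ?mulr_gt0 ?powR_gt0//;
  rewrite ?lnV ?lnA lnxi /gamma /D; field; rewrite Drp !gt_eqF.
Qed.

(** * Transport of the Lagrange conditions by a dilation *)

Section OptimalRecovery.
Context (R : realType) (L : lmodType R) (disp : measure_display).
Context (T : measurableType disp) (C : cone_in L T).
Context (mu : {measure set T -> \bar R}) (F : scalar_kind) (n : nat).
Context (psi : T -> scalars R F) (phi : 'I_n -> T -> scalars R F).
Context (d eta nu p q r delta I1 I2 : R) (k u : T -> R).
Hypothesis n_gt0 : (0 < n)%N.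
Hypothesis hom_mu : homogeneous_measure C mu d.
Hypothesis mpsi : scalar_measurable psi.
Hypothesis mphi : forall j, scalar_measurable (phi j).
Hypothesis hom_psi : homogeneous_modulus C psi eta.
Hypothesis hom_phi : forall j, homogeneous_modulus C (phi j) nu.
Hypothesis psi_phi_neq0 : {ae mu, forall t,
  psi t != 0 /\ \sum_(j < n) modulus (phi j t) != 0}.
Hypothesis delta_gt0 : 0 < delta.
Hypothesis nondeg : nu + d * (1 / r - 1 / p) != 0.
Hypothesis mk : measurable_fun setT k.
Hypothesis meas_u : measurable_fun setT u.
Hypothesis k01 : forall t, 0 <= k t <= 1.
Hypothesis u0 : forall t, 0 <= u t.
Hypothesis q1 : 1 <= q.
Hypothesis qp : q <= p.
Hypothesis qr : q <= r.
Hypothesis k_le : forall t, k t * modulus (psi t) `^ q <= u t `^ (p - q).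
Hypothesis kC_le : forall t, psi t != 0 -> \sum_(j < n) modulus (phi j t) != 0 ->
  (1 - k t) * modulus (psi t) `^ q <= s_sum phi r t * u t `^ (r - q).
Hypothesis stationarity : forall t,
  modulus (psi t) `^ q * u t `^ q = u t `^ p + s_sum phi r t * u t `^ r.
Hypothesis int_u : (\int[mu]_t (u t `^ p)%:E = I1%:E)%E.
Hypothesis int_phi_u : forall j,
  (\int[mu]_t ((modulus (phi j t) * u t) `^ r)%:E = I2%:E)%E.
Hypothesis I1_neq0 : I1 != 0.

Let q0 : 0 < q. Proof. exact: lt_le_trans ltr01 q1. Qed.
Let p0 : 0 < p. Proof. exact: lt_le_trans q0 qp. Qed.
Let r0 : 0 < r. Proof. exact: lt_le_trans q0 qr. Qed.

Let I1_gt0 : 0 < I1.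
Proof.
rewrite lt_neqAle eq_sym I1_neq0 -lee_fin -int_u.
by apply: integral_ge0 => t _; rewrite lee_fin powR_ge0.
Qed.

Let mup : measurable_fun setT (fun t => u t `^ p).
Proof. exact: (measurableT_comp (measurable_powR p)). Qed.

Let mphiu j : measurable_fun setT (fun t => (modulus (phi j t) * u t) `^ r).
Proof.
apply: (measurableT_comp (measurable_powR r)).
by apply: measurable_funM => //; exact: measurable_modulus.
Qed.

(** If [I2] were 0, every [phi j u] would vanish almost everywhere; as the [phi j] do not all vanish
    at almost any point, [u] would be 0 almost everywhere, and so would [I1] be 0. *)
Let I2_gt0 : 0 < I2.
Proof.
rewrite lt_neqAle -lee_fin -(int_phi_u (Ordinal n_gt0)).
rewrite integral_ge0 ?andbT; last first.
  by move=> t _; rewrite lee_fin powR_ge0.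
rewrite eq_sym; apply: contra I1_neq0 => /eqP I20.
have phiu_ae j : {ae mu, forall t, (modulus (phi j t) * u t) `^ r = 0}.
  have : (\int[mu]_t `|((modulus (phi j t) * u t) `^ r)%:E| = 0)%E.
    rewrite -[RHS](congr1 EFin I20) -(int_phi_u j); apply: eq_integral => t _.
    by rewrite gee0_abs// lee_fin powR_ge0.
  move/ae_eq_integral_abs => /(_ measurableT).
  have mE : measurable_fun setT (fun t => ((modulus (phi j t) * u t) `^ r)%:E).
    exact/measurable_EFinP.
  by move=> /(_ mE); apply: filterS => t /(_ I) [].
have all_ae : {ae mu, forall t, forall j, (modulus (phi j t) * u t) `^ r = 0}.
  by apply: filter_forall.
rewrite -eqe -int_u.
rewrite (ge0_ae_eq_integral (g := cst 0))//.
  by rewrite integral0.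
  exact/measurable_EFinP.
  by move=> t _; rewrite lee_fin powR_ge0.
apply: filterS2 psi_phi_neq0 all_ae => t [_ sn0] phiu0 _ /=.
congr EFin; apply/eqP; rewrite powR_eq0 (gt_eqF p0) andbT.
apply: contraNT sn0 => un0; rewrite big1// => j _.
have /eqP := phiu0 j; rewrite powR_eq0 => /andP[+ _].
by rewrite mulf_eq0 (negbTE un0) orbF => /eqP.
Qed.

(** [optimal_multiplier_method] is applied to [k (xi t)] and [v t = A * u (xi t)];
    [scaling_constants] supplies the normalizations and the value. *)
Lemma optimal_recovery_dilated :
  let gamma := (nu - eta - d * (1 / q - 1 / r)) / (nu + d * (1 / r - 1 / p)) in
  let xi := (delta * I1 `^ (- (1 / p)) * I2 `^ (1 / r))
              `^ (1 / (nu + d * (1 / r - 1 / p))) in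
  let m_hat := fun (y : T -> scalars R F) (t : T) =>
    of_real F (k (dil C xi t)) * psi t * y t in
  optimal_error mu psi phi p q r delta =
    (delta `^ gamma * I1 `^ (- (gamma / p)) * I2 `^ (- ((1 - gamma) / r)) *
     (I1 + n%:R * I2) `^ (1 / q))%:E /\
  optimal_method mu psi phi p q r delta m_hat.
Proof.
move=> gamma xi m_hat.
have [] := @scaling_constants R d eta nu p q r delta I1 I2 p0 q0 r0 delta_gt0
  I1_gt0 I2_gt0 nondeg.
have xi0 : 0 < xi by rewrite /xi powR_gt0// !mulr_gt0 ?powR_gt0.
rewrite -/gamma -/xi; set A := delta * _ * _; set V := delta `^ gamma * _ * _.
have A0 : 0 < A.
  exact: mulr_gt0 (mulr_gt0 delta_gt0 (powR_gt0 _ I1_gt0)) (powR_gt0 _ xi0).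
have V0 : 0 < V by rewrite /V !mulr_gt0 ?powR_gt0.
clearbody xi A V => int_v int_phi_v c1E c2E.
(* Substituting [|psi(t)|^q = xi^(- eta q) |psi(xi t)|^q], [s(xi t) = xi^(nu r) s(t)] and
   [u(xi t) = v(t) / A] in the split for [u] produces these multipliers. *)
pose c1 := xi `^ (- (eta * q)) * A `^ (q - p).
pose c2 := xi `^ (nu * r - eta * q) * A `^ (q - r).
have c2D : c2 = xi `^ (nu * r) * xi `^ (- (eta * q)) * A `^ (q - r).
  by rewrite /c2 [xi `^ (_ + _)]powRD// (gt_eqF xi0) implybT.
have psi_dil t : modulus (psi t) `^ q =
    xi `^ (- (eta * q)) * modulus (psi (dil C xi t)) `^ q.
  rewrite hom_psi// powRM ?powR_ge0 ?modulus_ge0// -powRrM mulrA -powRD; last first.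
    by rewrite (gt_eqF xi0) implybT.
  by rewrite addNr powRr0 mul1r.
have s_dil t : s_sum phi r (dil C xi t) = xi `^ (nu * r) * s_sum phi r t.
  rewrite /s_sum mulr_sumr; apply: eq_bigr => j _.
  by rewrite hom_phi// powRM ?powR_ge0 ?modulus_ge0// -powRrM.
have powA x y z : 0 <= z -> A `^ (x - y) * (A * z) `^ y = A `^ x * z `^ y.
  move=> z0; rewrite powRM ?(ltW A0)// mulrA -powRD ?subrK//.
  by rewrite (gt_eqF A0) implybT.
have powA0 x y z : 0 <= z -> A `^ (x - y) * (A * z) `^ (y - x) = z `^ (y - x).
  by move=> z0; rewrite -[x - y]opprB -[- _]add0r powA// powRr0 mul1r.
have mdil (f : T -> R) : measurable_fun setT f ->
    measurable_fun setT (fun t => f (dil C xi t)).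
  by move=> mf; apply: (measurableT_comp mf); exact: measurable_dil hom_mu _ xi0.
have [|||||||||||optE optM] :=
  @optimal_multiplier_method R disp T mu F n psi phi p q r c1 c2
  (fun t => k (dil C xi t)) (fun t => A * u (dil C xi t)) mpsi mphi _ _
  _ _ q1 qp qr _ _ _ _ delta delta_gt0 _ _ _.
- exact: mdil.
- by apply: measurable_funM => //; exact: mdil.
- by move=> t.
- by move=> t; rewrite mulr_ge0// ltW.
- by rewrite mulr_ge0 ?powR_ge0.
- by rewrite mulr_ge0 ?powR_ge0.
- move=> t; rewrite psi_dil /c1 -mulrA powA0// mulrCA.
  by rewrite ler_wpM2l ?powR_ge0.
(* The split is needed at [xi t], while nonvanishing is known at almost every [t]; homogeneity
   carries it from [t] to [xi t]. *)
- apply: filterS psi_phi_neq0 => t [psin0 phin0].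
  have psin0' : psi (dil C xi t) != 0.
    rewrite -modulus_eq0 hom_psi// mulf_neq0 ?modulus_eq0//.
    by rewrite gt_eqF// powR_gt0.
  have phin0' : \sum_(j < n) modulus (phi j (dil C xi t)) != 0.
    under eq_bigr do rewrite hom_phi//.
    by rewrite -mulr_sumr mulf_neq0// gt_eqF// powR_gt0.
  have := kC_le psin0' phin0'; rewrite s_dil => kC.
  rewrite psi_dil mulrCA.
  apply: le_trans (ler_wpM2l (powR_ge0 xi _) kC) _.
  rewrite -[u (dil C xi t) `^ _](powA0 q)// c2D.
  by rewrite le_eqVlt; apply/orP; left; apply/eqP; ring.
- under eq_integral do rewrite powRM ?(ltW A0)//.
  rewrite ge0_integral_EFinZl ?powR_ge0//;
    [|exact: (mdil _ mup)|by move=> t; exact: powR_ge0].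
  rewrite (integral_dil hom_mu xi0 (f := fun t => u t `^ p))//;
    last by move=> t; exact: powR_ge0.
  by rewrite int_u -!EFinM int_v.
- move=> j.
  transitivity (\int[mu]_t (((xi `^ (- nu) * A) `^ r) *
     (modulus (phi j (dil C xi t)) * u (dil C xi t)) `^ r)%:E)%E.
    apply: eq_integral => t _; congr EFin.
    rewrite hom_phi// -powRM ?mulr_ge0 ?modulus_ge0 ?powR_ge0 ?(ltW A0)//.
    have xinu : xi `^ (- nu) * xi `^ nu = 1.
      by rewrite powRN mulVf// gt_eqF// powR_gt0.
    by congr (_ `^ _); rewrite -[LHS]mul1r -xinu; ring.
  rewrite ge0_integral_EFinZl ?powR_ge0//;
    [|exact: (mdil _ (mphiu j))|by move=> t; exact: powR_ge0].
  rewrite (integral_dil hom_mu xi0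
    (f := fun t => (modulus (phi j t) * u t) `^ r))//;
    last by move=> t; exact: powR_ge0.
  by rewrite int_phi_u -!EFinM int_phi_v.
- move=> t; rewrite psi_dil {1}powRM ?(ltW A0)//.
  have -> : c1 * (A * u (dil C xi t)) `^ p =
      xi `^ (- (eta * q)) * (A `^ q * u (dil C xi t) `^ p) by rewrite -powA// mulrA.
  have -> : c2 * s_sum phi r t * (A * u (dil C xi t)) `^ r =
      xi `^ (- (eta * q)) *
      (A `^ q * (s_sum phi r (dil C xi t) * u (dil C xi t) `^ r)).
    rewrite (mulrCA (A `^ q)) -powA// s_dil c2D; ring.
  by rewrite [LHS]mulrACA stationarity; ring.
split; last exact: optM.
rewrite optE /c1 /c2 c1E c2E; congr EFin.
(* Both terms contain the factor [V^q], whose [q]-th root is the prefactor of the claimed value. *)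
rewrite (_ : _ + _ = V `^ q * (I1 + n%:R * I2)); last by ring.
rewrite powRM ?powR_ge0 ?addr_ge0 ?mulr_ge0 ?(ltW I1_gt0) ?(ltW I2_gt0)//.
by rewrite -powRrM div1r mulfV ?gt_eqF// powRr1// ltW.
Qed.

End OptimalRecovery.

(** * The three parameter ranges *)

Section SaddleFunctions.
Context (R : realType) (F : scalar_kind) (disp : measure_display).
Context (T : measurableType disp) (n : nat).
Context (psi : T -> scalars R F) (phi : 'I_n -> T -> scalars R F).
Context (p q r : R).
Hypothesis mpsi : scalar_measurable psi.
Hypothesis mphi : forall j, scalar_measurable (phi j).

Lemma s_sum_ge0 t : 0 <= s_sum phi r t.
Proof. by apply: sumr_ge0 => j _; exact: powR_ge0. Qed.

Lemma s_sum_gt0 t :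
  0 < r -> \sum_(j < n) modulus (phi j t) != 0 -> 0 < s_sum phi r t.
Proof.
move=> r0 sn0; rewrite lt_neqAle s_sum_ge0 andbT eq_sym; apply: contra sn0.
rewrite /s_sum psumr_eq0; last by move=> j _; exact: powR_ge0.
move=> /allP s0; rewrite big1// => j _; apply/eqP.
by have := s0 j (mem_index_enum _); rewrite powR_eq0 => /andP[].
Qed.

Lemma measurable_s_sum : measurable_fun setT (s_sum phi r).
Proof.
by apply: measurable_sum => j; exact: measurable_powR_modulus.
Qed.

(** Where [u] is nonzero, add the two relations and multiply by [u^q]. They are not asked for at
    [u = 0]: there [u^0 = 1] could break them when [p = q] or [r = q], while the conclusion is
    [0 = 0]. *)
Lemma stationarity_split (k a s u : R) : 0 < q -> q <= p -> q <= r -> 0 <= u ->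
  (u != 0 -> k * a = u `^ (p - q) /\ (1 - k) * a = s * u `^ (r - q)) ->
  a * u `^ q = u `^ p + s * u `^ r.
Proof.
move=> q0 qp qr u0 split_u.
have p0 := lt_le_trans q0 qp; have r0 := lt_le_trans q0 qr.
have [->|un0] := eqVneq u 0; first by rewrite !powR0 ?gt_eqF// !mulr0 addr0.
have [ka kCa] := split_u un0.
have -> : a = k * a + (1 - k) * a by ring.
by rewrite ka kCa mulrDl -mulrA -!powRD ?subrK ?un0 ?implybT.
Qed.

(* The function [u] on P and on P1. *)
Definition weight_extremal (k : T -> R) (t : T) : R :=
  (modulus (psi t) `^ q * k t) `^ (1 / (p - q)).

Lemma weight_extremal_ge0 k t : 0 <= weight_extremal k t.
Proof. exact: powR_ge0. Qed.

Lemma measurable_weight_extremal k : measurable_fun setT k ->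
  measurable_fun setT (weight_extremal k).
Proof.
move=> mk; apply: (measurableT_comp (measurable_powR _)).
by apply: measurable_funM => //; exact: measurable_powR_modulus.
Qed.

(** For [x = p] and [x = r] this identifies the integrands of [I_psi] and [I_phi] with [u^p] and
    [(b j u)^r]. *)
Lemma weight_extremal_powR k t x : 0 <= k t -> weight_extremal k t `^ x =
  modulus (psi t) `^ (q * x / (p - q)) * k t `^ (x / (p - q)).
Proof.
move=> k0; rewrite /weight_extremal -powRrM powRM ?powR_ge0// -powRrM.
by rewrite div1r (mulrC _ x) mulrA.
Qed.

Lemma weight_extremal_mul k t : q < p -> 0 <= k t ->
  k t * modulus (psi t) `^ q = weight_extremal k t `^ (p - q).
Proof.
move=> qp k0; rewrite weight_extremal_powR// -mulrA divff ?subr_eq0 ?gt_eqF//.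
by rewrite mulr1 powRr1// mulrC.
Qed.

Lemma weight_extremal_neq0 k t : q < p -> 0 < q -> weight_extremal k t != 0 ->
  0 < modulus (psi t) /\ k t != 0.
Proof.
move=> qp q0 un0.
have e0 : 1 / (p - q) != 0 by rewrite gt_eqF// divr_gt0// subr_gt0.
split; last first.
  by apply: contra un0 => /eqP k0; rewrite /weight_extremal k0 mulr0 powR0.
rewrite lt_neqAle modulus_ge0 andbT eq_sym; apply: contra un0 => /eqP a0.
by rewrite /weight_extremal a0 [0 `^ q]powR0 ?(gt_eqF q0)// mul0r powR0.
Qed.

End SaddleFunctions.

(** * The range P: q < p and q < r *)

Section WeightP.
Context (R : realType) (F : scalar_kind) (disp : measure_display).
Context (T : measurableType disp) (n : nat).
Context (psi : T -> scalars R F) (phi : 'I_n -> T -> scalars R F).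
Context (p q r : R).
Hypothesis mpsi : scalar_measurable psi.
Hypothesis mphi : forall j, scalar_measurable (phi j).
Hypothesis q1 : 1 <= q.
Hypothesis qp : q < p.
Hypothesis qr : q < r.

Local Notation a t := (modulus (psi t)).
Let pq0 : 0 < 1 / (p - q). Proof. by rewrite divr_gt0// subr_gt0. Qed.
Let rq0 : 0 < 1 / (r - q). Proof. by rewrite divr_gt0// subr_gt0. Qed.
Let q0 : 0 < q. Proof. exact: lt_le_trans ltr01 q1. Qed.

Local Notation rho t := (s_sum phi r t `^ (- (1 / (r - q))) *
  a t `^ (q * (p - r) / ((p - q) * (r - q)))).
Local Notation k := (k_P psi phi p q r).

Lemma k_PE t : k t = unit_root (1 / (p - q)) (1 / (r - q)) (rho t).
Proof. by []. Qed.

Lemma measurable_k_P : measurable_fun setT k.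
Proof.
apply: (measurableT_comp (measurable_unit_root pq0 rq0)).
apply: measurable_funM; last exact: measurable_powR_modulus.
by apply: (measurableT_comp (measurable_powR _)); exact: measurable_s_sum.
Qed.

Lemma k_P_spec t : 0 <= k t < 1 /\
  k t `^ (1 / (p - q)) / (1 - k t) `^ (1 / (r - q)) = rho t.
Proof. by rewrite k_PE; apply: unit_rootP => //; rewrite mulr_ge0 ?powR_ge0. Qed.

Local Notation u := (weight_extremal psi p q k).

(** Raising the defining equation to the power [r - q] expresses [k^((r - q) / (p - q))], which is
    [u^(r - q)] up to a power of [|psi|], through [(1 - k) / s]. *)
Lemma k_P_complement t : 0 < a t -> 0 < s_sum phi r t ->
  (1 - k t) * a t `^ q = s_sum phi r t * u t `^ (r - q).
Proof.
move=> a0 s0; have [/andP[k0 k1] kE] := k_P_spec t.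
have pqN0 : p - q != 0 by rewrite subr_eq0 gt_eqF.
have rqN0 : r - q != 0 by rewrite subr_eq0 gt_eqF.
have kE' : k t `^ (1 / (p - q) * (r - q)) = (1 - k t) * ((s_sum phi r t)^-1 *
    a t `^ (q - q / (p - q) * (r - q))).
  have : (k t `^ (1 / (p - q)) / (1 - k t) `^ (1 / (r - q))) `^ (r - q) =
      rho t `^ (r - q) by rewrite kE.
  rewrite !powRM ?invr_ge0 ?powR_ge0// -!powRrM.
  rewrite -powRN -!powRrM.
  rewrite (_ : - (1 / (r - q)) * (r - q) = -1); last by field.
  rewrite (_ : q * (p - r) / ((p - q) * (r - q)) * (r - q) =
    q - q / (p - q) * (r - q)); last first.
    by field; rewrite pqN0 rqN0.
  rewrite !powR_inv1 ?subr_ge0 ?s_sum_ge0 ?(ltW k1)// => E.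
  by rewrite -E mulrCA mulfV ?mulr1// subr_eq0 gt_eqF.
rewrite /weight_extremal -powRrM powRM ?powR_ge0// -powRrM.
have aD : a t `^ q = a t `^ (q * (1 / (p - q) * (r - q))) *
    a t `^ (q - q / (p - q) * (r - q)).
  by rewrite -powRD ?(gt_eqF a0) ?implybT//; congr (_ `^ _); field; rewrite pqN0.
by rewrite kE' aD; field; rewrite gt_eqF.
Qed.

(* The right-hand side vanishes here because [0 `^ x = 0] also for [x < 0]. *)
Lemma k_P_sum_eq0 t : s_sum phi r t = 0 -> k t = 0.
Proof.
have [/andP[k0 k1] kE] := k_P_spec t; move=> s0; move: kE.
rewrite s0 powR0 ?oppr_eq0 ?gt_eqF// mul0r => /eqP.
rewrite mulf_eq0 invr_eq0 !powR_eq0 subr_eq0 [1 == _]gt_eqF// orbF.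
by move=> /andP[/eqP].
Qed.

(** Where [u] is nonzero so is [k], hence [s > 0] by [k_P_sum_eq0] and both split relations are
    available; the identity thus holds at every point. *)
Lemma k_P_stationarity t :
  a t `^ q * u t `^ q = u t `^ p + s_sum phi r t * u t `^ r.
Proof.
have [/andP[k0 k1] _] := k_P_spec t.
apply: (@stationarity_split _ _ _ _ (k t)) => //;
  [exact: ltW|exact: ltW|exact: powR_ge0|].
move=> /weight_extremal_neq0[]// a0 kn0; split; first exact: weight_extremal_mul.
apply: k_P_complement => //.
rewrite lt_neqAle s_sum_ge0 andbT eq_sym; apply: contra kn0 => /eqP s0.
by rewrite k_P_sum_eq0.
Qed.

End WeightP.

(** * The range P1: q = r < p *)

Section WeightP1.
Context (R : realType) (F : scalar_kind) (disp : measure_display).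
Context (T : measurableType disp) (n : nat).
Context (psi : T -> scalars R F) (phi : 'I_n -> T -> scalars R F).
Context (p q : R).
Hypothesis mpsi : scalar_measurable psi.
Hypothesis mphi : forall j, scalar_measurable (phi j).
Hypothesis q1 : 1 <= q.
Hypothesis qp : q < p.

Let q0 : 0 < q. Proof. exact: lt_le_trans ltr01 q1. Qed.
Local Notation k := (k_P1 psi phi q).
Local Notation u := (weight_extremal psi p q k).

Lemma measurable_k_P1 : measurable_fun setT k.
Proof.
apply: measurable_maxr; last exact: measurable_cst.
apply: measurable_funB; first exact: measurable_cst.
by apply: measurable_funM; [exact: measurable_powR_modulus|exact: measurable_s_sum].
Qed.

Lemma k_P1_itv t : 0 <= k t <= 1.
Proof.
rewrite /k_P1 le_max lexx orbT ge_max ler01 andbT gerBl.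
by rewrite mulr_ge0 ?powR_ge0 ?s_sum_ge0.
Qed.

(** Truncation at 0 only increases [k], whence an inequality. The factor [u^0] equals 1 even where
    [u] vanishes. *)
Lemma k_P1_complement_le t : psi t != 0 ->
  (1 - k t) * modulus (psi t) `^ q <= s_sum phi q t * u t `^ (q - q).
Proof.
move=> psin0; rewrite subrr powRr0 mulr1.
have a0 : 0 < modulus (psi t) `^ q.
  by rewrite powR_gt0// lt_neqAle modulus_ge0 eq_sym modulus_eq0 psin0.
rewrite -ler_pdivlMr// mulrC -powRN lerBlDr -lerBlDl.
by rewrite /k_P1 le_max lexx.
Qed.

Lemma k_P1_stationarity t :
  modulus (psi t) `^ q * u t `^ q = u t `^ p + s_sum phi q t * u t `^ q.
Proof.
have /andP[k0 k1] := k_P1_itv t.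
apply: (@stationarity_split _ _ _ _ (k t)) => //; [exact: ltW|exact: powR_ge0|].
move=> /weight_extremal_neq0[]// a0 kn0; split; first exact: weight_extremal_mul.
(* Since [k] is nonzero the truncation is inactive, and the relation becomes an equality. *)
rewrite subrr powRr0 mulr1 /k_P1 max_l; last first.
  rewrite leNgt; apply: contra kn0 => h; rewrite /k_P1 max_r// ltW//.
by rewrite subKr mulrAC powRN mulVf ?mul1r// gt_eqF// powR_gt0.
Qed.

End WeightP1.

(** * The range P2: q = p < r *)

Section WeightP2.
Context (R : realType) (F : scalar_kind) (disp : measure_display).
Context (T : measurableType disp) (n : nat).
Context (psi : T -> scalars R F) (phi : 'I_n -> T -> scalars R F).
Context (p r : R).
Hypothesis mpsi : scalar_measurable psi.
Hypothesis mphi : forall j, scalar_measurable (phi j).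
Hypothesis p1 : 1 <= p.
Hypothesis pr : p < r.

Let p0 : 0 < p. Proof. exact: lt_le_trans ltr01 p1. Qed.
Local Notation a t := (modulus (psi t)).
Local Notation k := (k_P2 psi p).

(** For [q = p] the relation [k a^p = u^0] does not determine [u]. It is solved instead from
    [(1 - k) a^p = s u^(r - p)], whose left-hand side is the positive part of [a^p - 1]. *)
Definition extremal_P2 (t : T) : R :=
  ((s_sum phi r t)^-1 * Num.max (modulus (psi t) `^ p - 1) 0) `^ (1 / (r - p)).
Local Notation u := extremal_P2.

Lemma measurable_k_P2 : measurable_fun setT k.
Proof.
apply: measurable_minr; first exact: measurable_cst.
exact: measurable_powR_modulus.
Qed.

Lemma measurable_extremal_P2 : measurable_fun setT u.
Proof.
apply: (measurableT_comp (measurable_powR _)); apply: measurable_funM.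
  under eq_fun do rewrite -powR_inv1 ?s_sum_ge0//.
  by apply: (measurableT_comp (measurable_powR _)); exact: measurable_s_sum.
apply: measurable_maxr; last exact: measurable_cst.
apply: measurable_funB; last exact: measurable_cst.
exact: measurable_powR_modulus.
Qed.

Lemma k_P2_itv t : 0 <= k t <= 1.
Proof. by rewrite /k_P2 le_min ler01 powR_ge0 ge_min lexx. Qed.

Lemma k_P2_mul_le t : k t * a t `^ p <= u t `^ (p - p).
Proof.
rewrite subrr powRr0; have [a0|an0] := eqVneq (a t) 0.
  by rewrite a0 powR0 ?gt_eqF// mulr0.
rewrite -ler_pdivlMr ?powR_gt0 ?lt_neqAle 1?eq_sym ?an0 ?modulus_ge0//.
by rewrite div1r -powRN /k_P2 ge_min lexx orbT.
Qed.

Lemma k_P2_complement t : 0 < a t -> 0 < s_sum phi r t ->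
  (1 - k t) * a t `^ p = s_sum phi r t * u t `^ (r - p).
Proof.
move=> a0 s0; have ap0 : 0 < a t `^ p by rewrite powR_gt0.
rewrite /extremal_P2 -powRrM mulrC (_ : 1 / (r - p) * (r - p) = 1); last first.
  by field; rewrite subr_eq0 gt_eqF.
rewrite powRr1 ?mulr_ge0 ?invr_ge0 ?s_sum_ge0 ?le_max ?lexx ?orbT//.
rewrite mulrA divff ?gt_eqF// mul1r /k_P2 powRN.
have [a1|a1] := leP (a t `^ p) 1.
  by rewrite min_l ?invf_ge1// max_r ?subr_le0// subrr mulr0.
rewrite min_r ?max_l ?subr_ge0 ?ltW// ?invf_lt1//.
by rewrite mulrBr mulr1 mulfV// gt_eqF.
Qed.

Lemma k_P2_stationarity t :
  a t `^ p * u t `^ p = u t `^ p + s_sum phi r t * u t `^ r.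
Proof.
have e0 : 1 / (r - p) != 0 by rewrite gt_eqF// divr_gt0// subr_gt0.
apply: (@stationarity_split _ _ _ _ (k t)) => //; [exact: ltW|exact: powR_ge0|].
move=> un0.
(* The inverse of 0 is 0, so [u] would vanish if the sum did. *)
have s0 : 0 < s_sum phi r t.
  rewrite lt_neqAle s_sum_ge0 andbT eq_sym; apply: contra un0 => /eqP s0.
  by rewrite /extremal_P2 s0 invr0 mul0r powR0.
have a1 : 1 < a t `^ p.
  rewrite ltNge; apply: contra un0 => a1.
  by rewrite /extremal_P2 max_r ?subr_le0// mulr0 powR0.
have a0 : 0 < a t.
  rewrite lt_neqAle modulus_ge0 andbT eq_sym; apply: contraTN a1 => /eqP ->.
  by rewrite powR0 ?gt_eqF// ltr10.
split; last exact: k_P2_complement.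
rewrite subrr powRr0 /k_P2 powRN min_r ?mulVf ?gt_eqF ?powR_gt0//.
by rewrite ltW// invf_lt1// powR_gt0.
Qed.

End WeightP2.

(* I1 and I2 are the (finite) values of the integrals, I2 being the common value
   of the integrals attached to the phi j.  The hypothesis I1 != 0 makes the
   negative powers of I1 and I2 in the conclusion meaningful (it forces
   I2 != 0); the library's power function is total, with 0 `^ a = 0 for
   a != 0. *)
Theorem theorem4 (R : realType) (L : lmodType R) (disp : measure_display)
    (T : measurableType disp) (C : cone_in L T)
    (mu : {measure set T -> \bar R}) (F : scalar_kind) (n : nat)
    (psi : T -> scalars R F) (phi : 'I_n -> T -> scalars R F)
    (d eta nu p q r delta I1 I2 : R)
    (n_gt0 : (0 < n)%N)
    (hom_mu : homogeneous_measure C mu d)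
    (mpsi : scalar_measurable psi)
    (mphi : forall j, scalar_measurable (phi j))
    (hom_psi : homogeneous_modulus C psi eta)
    (hom_phi : forall j, homogeneous_modulus C (phi j) nu)
    (psi_phi_neq0 : {ae mu, forall t,
       psi t != 0 /\ \sum_(j < n) modulus (phi j t) != 0})
    (delta_gt0 : 0 < delta)
    (pqr : in_P p q r || in_P1 p q r || in_P2 p q r)
    (Lambda_Lq : forall x, domainW mu phi p r x ->
       Lp mu q (fun t => psi t * x t))
    (nondeg : nu + d * (1 / r - 1 / p) != 0)
    (I1E : I_psi mu psi phi p q r = I1%:E)
    (I2E : forall j, I_phi mu psi phi p q r j = I2%:E)
    (I1_neq0 : I1 != 0) :
  let gamma := (nu - eta - d * (1 / q - 1 / r)) / (nu + d * (1 / r - 1 / p)) in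
  let xi := (delta * I1 `^ (- (1 / p)) * I2 `^ (1 / r))
              `^ (1 / (nu + d * (1 / r - 1 / p))) in
  let m_hat := fun (y : T -> scalars R F) (t : T) =>
    of_real F (k_fun psi phi p q r (dil C xi t)) * psi t * y t in
  optimal_error mu psi phi p q r delta =
    (delta `^ gamma * I1 `^ (- (gamma / p)) * I2 `^ (- ((1 - gamma) / r)) *
     (I1 + n%:R * I2) `^ (1 / q))%:E /\
  optimal_method mu psi phi p q r delta m_hat.
Proof.
move=> gamma xi m_hat.
case/orP: pqr => [/orP[]|] /and3P[q1 h1 h2].
- have P1F : in_P2 p q r = false by rewrite /in_P2 lt_eqF// andbF.
  have kE : k_fun psi phi p q r = k_P psi phi p q r.
    by apply/funext => t; rewrite /k_fun /in_P q1 h1 h2.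
  have k01 t : 0 <= k_P psi phi p q r t <= 1.
    by have [/andP[k0 /ltW k1] _] := k_P_spec psi phi h1 h2 t; rewrite k0.
  have k0 t : 0 <= k_P psi phi p q r t by case/andP: (k01 t).
  have mk := measurable_k_P mpsi mphi h1 h2.
  rewrite /m_hat kE.
  apply: (@optimal_recovery_dilated R L disp T C mu F n psi phi d eta nu p q r delta
    I1 I2 (k_P psi phi p q r) (weight_extremal psi p q (k_P psi phi p q r))) => //.
  + exact: measurable_weight_extremal.
  + by move=> t; exact: weight_extremal_ge0.
  + exact: ltW.
  + exact: ltW.
  + by move=> t; rewrite (weight_extremal_mul psi h1 (k0 t)).
  + move=> t psin0 /s_sum_gt0 s0; rewrite k_P_complement//.
      by rewrite lt_neqAle modulus_ge0 eq_sym modulus_eq0 psin0.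
    by apply: s0; exact: lt_trans (lt_le_trans ltr01 q1) h2.
  + by move=> t; exact: k_P_stationarity.
  + rewrite -I1E /I_psi P1F kE; apply: eq_integral => t _.
    by rewrite weight_extremal_powR.
  + move=> j; rewrite -(I2E j) /I_phi P1F kE; apply: eq_integral => t _.
    rewrite powRM ?modulus_ge0 ?weight_extremal_ge0// weight_extremal_powR//.
    by rewrite mulrCA mulrA.
- move/eqP: h1 => h1; subst r.
  have P0F : in_P p q q = false by rewrite /in_P ltxx !andbF.
  have P1F : in_P2 p q q = false by rewrite /in_P2 lt_eqF// andbF.
  have kE : k_fun psi phi p q q = k_P1 psi phi q.
    by apply/funext => t; rewrite /k_fun P0F /in_P1 q1 eqxx h2.
  have k01 t := k_P1_itv psi phi q t.
  have k0 t : 0 <= k_P1 psi phi q t by case/andP: (k01 t).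
  have mk := measurable_k_P1 q mpsi mphi.
  rewrite /m_hat kE.
  apply: (@optimal_recovery_dilated R L disp T C mu F n psi phi d eta nu p q q delta
    I1 I2 (k_P1 psi phi q) (weight_extremal psi p q (k_P1 psi phi q))) => //.
  + exact: measurable_weight_extremal.
  + by move=> t; exact: weight_extremal_ge0.
  + exact: ltW.
  + by move=> t; rewrite (weight_extremal_mul psi h2 (k0 t)).
  + by move=> t psin0 _; exact: k_P1_complement_le.
  + by move=> t; exact: k_P1_stationarity.
  + rewrite -I1E /I_psi P1F kE; apply: eq_integral => t _.
    by rewrite weight_extremal_powR.
  + move=> j; rewrite -(I2E j) /I_phi P1F kE; apply: eq_integral => t _.
    rewrite powRM ?modulus_ge0 ?weight_extremal_ge0// weight_extremal_powR//.
    by rewrite mulrCA mulrA.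
- move/eqP: h1 => h1; subst q.
  have P0F : in_P p p r = false by rewrite /in_P ltxx !andbF.
  have P1F : in_P1 p p r = false by rewrite /in_P1 lt_eqF// andbF.
  have P2T : in_P2 p p r by rewrite /in_P2 q1 eqxx h2.
  have kE : k_fun psi phi p p r = k_P2 psi p.
    by apply/funext => t; rewrite /k_fun P0F P1F.
  rewrite /m_hat kE.
  (* With [x = p] and [x = r], this turns the integrands of [I_psi] and [I_phi] into those of
     [u]. *)
  have uE t x : ((s_sum phi r t)^-1 * Num.max (modulus (psi t) `^ p - 1) 0)
      `^ (x / (r - p)) = extremal_P2 psi phi p r t `^ x.
    by rewrite /extremal_P2 -powRrM div1r (mulrC _ x).
  apply: (@optimal_recovery_dilated R L disp T C mu F n psi phi d eta nu p p r delta
    I1 I2 (k_P2 psi p) (extremal_P2 psi phi p r)) => //.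
  + exact: measurable_k_P2.
  + exact: measurable_extremal_P2.
  + by move=> t; exact: k_P2_itv.
  + by move=> t; exact: powR_ge0.
  + exact: ltW.
  + by move=> t; exact: k_P2_mul_le.
  + move=> t psin0 /s_sum_gt0 s0; rewrite (@k_P2_complement _ _ _ _ _ _ phi _ r)//.
      by rewrite lt_neqAle modulus_ge0 eq_sym modulus_eq0 psin0.
    by apply: s0; exact: lt_trans (lt_le_trans ltr01 q1) h2.
  + by move=> t; exact: k_P2_stationarity.
  + by rewrite -I1E /I_psi P2T; apply: eq_integral => t _; rewrite uE.
  + move=> j; rewrite -(I2E j) /I_phi P2T; apply: eq_integral => t _.
    by rewrite uE powRM ?modulus_ge0 ?powR_ge0.
Qed.
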